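(* Let $d\ge 2$, let $\mathcal D\subset\mathbb R^d$ be a bounded domain with $C^{1,1}$ boundary and $0\in\mathcal D$, let $c:\mathcal D\to\mathbb R$ be bounded and continuous, and let $\Psi\in\mathcal B_0$ (with zero drift) satisfy the WLSC property. Let $u\in C_{\rm b}(\mathbb R^d)$ be a viscosity sub-solution of $$-\Psi(-\Delta)u+c\,u=0\quad\text{in }\mathcal D,\qquad\text{with}\qquad u\le 0\quad\text{in }\mathcal D^c .$$ There exists $\varepsilon=\varepsilon(\Psi,\operatorname{diam}\mathcal D,\|c\|_\infty)>0$ (depending on $\mathcal D$ and $c$ only through $\operatorname{diam}\mathcal D$ and $\|c\|_\infty$, and not on $u$) such that $u\le 0$ in $\mathbb R^d$ whenever $|\mathcal D|<\varepsilon$, where $|\mathcal D|$ denotes Lebesgue measure.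
   Context: A Bernstein function is $\Psi\in C^\infty((0,\infty))$ with $\Psi\ge 0$ and $(-1)^n\Psi^{(n)}\le 0$ for all $n\ge1$; $\mathcal B_0$ is the set of Bernstein functions with $\lim_{x\downarrow 0}\Psi(x)=0$. Zero drift means $\Psi(x)=\int_{(0,\infty)}(1-e^{-yx})\,\mathfrak m(dy)$ for a Borel measure $\mathfrak m$ on $(0,\infty)$ with $\int (y\wedge 1)\,\mathfrak m(dy)<\infty$. Set $j(r)=\int_0^\infty(4\pi t)^{-d/2}e^{-r^2/(4t)}\,\mathfrak m(dt)$, $r>0$; it is assumed that $j:(0,\infty)\to(0,\infty)$ (i.e. $\Psi\not\equiv 0$). WLSC (weak lower scaling): there are $\underline\mu>0$, $\underline c\in(0,1]$, $\underline\theta\ge 0$ with $\Psi(\gamma x)\ge\underline c\,\gamma^{\underline\mu}\Psi(x)$ for all $x>\underline\theta$, $\gamma\ge 1$. $C_{\rm b}(\mathbb R^d)$ is the space of bounded continuous functions on $\mathbb R^d$. $C^2_{\rm b}(x)$ is the set of bounded (Borel) functions on $\mathbb R^d$ that are twice continuously differentiable in a neighbourhood of $x$. For $\varphi\in C^2_{\rm b}(x)$, $$-\Psi(-\Delta)\varphi(x)=\tfrac12\int_{\mathbb R^d}\big(\varphi(x+z)+\varphi(x-z)-2\varphi(x)\big)j(|z|)\,dz .$$ Viscosity sub-solution: $u\in C_{\rm b}(\mathbb R^d)$ is a viscosity sub-solution of $-\Psi(-\Delta)u+c\,u=h$ in $\mathcal D$ if for every $x\in\mathcal D$ and every $\varphi\in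 C^2_{\rm b}(x)$ with $\varphi(x)=u(x)$ and $\varphi(y)>u(y)$ for $y\ne x$, one has $-\Psi(-\Delta)\varphi(x)+c(x)u(x)\ge h(x)$. *)

(* Defs.v *)
From HB Require Import structures.
From mathcomp Require Import all_boot all_order all_algebra.
From mathcomp Require Import all_classical all_reals all_analysis.

Set Implicit Arguments.
Unset Strict Implicit.
Unset Printing Implicit Defensive.

Import Order.TTheory GRing.Theory Num.Theory.
Import numFieldNormedType.Exports.

Local Open Scope classical_set_scope.
Local Open Scope ring_scope.

(* The topology and boundedness notions on 'rV[R]_n come from the library's
   sup norm `|x|; the Euclidean norm is used wherever the value of the norm
   matters. *)
Definition enorm {R : realType} {n : nat} (x : 'rV[R]_n) : R :=
  Num.sqrt (\sum_(i < n) x ord0 i ^+ 2).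

(* R^n carries the sigma-algebra generated by the coordinate maps (the library
   does the same for n.-tuple T); R^n being second countable, this is the Borel
   sigma-algebra. *)
Section measurable_rV.
Context {R : realType} (n : nat).

Definition coord_rV (i : 'I_n) (x : 'rV[R]_n) : measurableTypeR R := x ord0 i.

Let rV_set0 : g_sigma_preimage coord_rV set0.
Proof. exact: sigma_algebra0. Qed.

Let rV_setC A : g_sigma_preimage coord_rV A -> g_sigma_preimage coord_rV (~` A).
Proof. exact: sigma_algebraC. Qed.

Let rV_bigcup (F : (set 'rV[R]_n)^nat) :
  (forall i, g_sigma_preimage coord_rV (F i)) ->
  g_sigma_preimage coord_rV (\bigcup_i F i).
Proof. exact: sigma_algebra_bigcup. Qed.

HB.instance Definition _ := @isMeasurable.Build default_measure_display
  'rV[R]_n (g_sigma_preimage coord_rV) rV_set0 rV_setC rV_bigcup.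

Lemma measurable_coord_rV (i : 'I_n) : measurable_fun setT (coord_rV i).
Proof.
move=> _ Y mY; rewrite setTI; apply: sub_sigma_algebra => /=.
rewrite -bigcup_seq/=; exists i => /=; first by rewrite mem_index_enum.
by exists Y => //; rewrite setTI.
Qed.

Lemma measurable_fun_rVP d (T : measurableType d) (f : T -> 'rV[R]_n) :
  measurable_fun setT f <->
  forall i, measurable_fun setT (coord_rV i \o f).
Proof.
split=> [mf i|mf]; first exact: (measurableT_comp (measurable_coord_rV i)).
suff : g_sigma_preimage coord_rV `<=`
    [set A | measurable (f @^-1` A)].
  by move=> H _ A mA; rewrite setTI; exact: H.
apply: smallest_sub.
  split=> /=.
  - by rewrite preimage_set0.
  - by move=> A mA; rewrite setTD preimage_setC; exact: measurableC.
  - by move=> F mF; rewrite preimage_bigcup; exact: bigcupT_measurable.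
rewrite -bigcup_seq => A [i _ [B mB <-]] /=.
by rewrite setTI; have := mf i measurableT _ mB; rewrite setTI.
Qed.

End measurable_rV.

(* (a, (x_0, .., x_{n-1})) |-> (a, x_0, .., x_{n-1}) *)
Definition cons_rV {R : realType} {n : nat}
    (p : measurableTypeR R * 'rV[R]_n) : 'rV[R]_n.+1 :=
  \row_i oapp (p.2 ord0) p.1 (unlift ord0 i).

Lemma measurable_cons_rV {R : realType} {n : nat} :
  measurable_fun setT (@cons_rV R n).
Proof.
apply/measurable_fun_rVP => i; case: (unliftP ord0 i) => [j ij|i0].
- have -> : coord_rV i \o @cons_rV R n = coord_rV j \o snd.
    by apply/funext => p /=; rewrite /coord_rV /cons_rV mxE ij liftK.
  exact: (measurableT_comp (measurable_coord_rV j)).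
- have -> : coord_rV i \o @cons_rV R n = fst.
    by apply/funext => p /=; rewrite /coord_rV /cons_rV mxE i0 unlift_none.
  exact: measurable_fst.
Qed.

(* Lebesgue measure on R^n: the n-fold product of the one-dimensional one. *)
Fixpoint lebesgue_rV (R : realType) (n : nat) : set 'rV[R]_n -> \bar R :=
  match n with
  | 0%N => dirac (0 : 'rV[R]_0)
  | k.+1 =>
      pushforward (product_measure1 (@lebesgue_measure R) (@lebesgue_rV R k))
        cons_rV
  end.


Section cons_measure.
Context {R : realType} (n : nat).
Variable mu : {sigma_finite_measure set 'rV[R]_n -> \bar R}.

Definition cons_measure : set 'rV[R]_n.+1 -> \bar R :=
  pushforward (product_measure1 (@lebesgue_measure R) mu) cons_rV.

Let mcons (A : set 'rV[R]_n.+1) :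
  measurable A -> measurable (@cons_rV R n @^-1` A).
Proof.
by move=> mA; rewrite -[X in measurable X]setTI; exact: measurable_cons_rV.
Qed.

Let cons_measure0 : cons_measure set0 = 0%E.
Proof. by rewrite /cons_measure /pushforward preimage_set0 measure0. Qed.

Let cons_measure_ge0 A : (0 <= cons_measure A)%E.
Proof. by rewrite /cons_measure /pushforward; exact: measure_ge0. Qed.

Let cons_measure_sigma_additive : semi_sigma_additive cons_measure.
Proof.
move=> F mF tF mUF; rewrite /cons_measure /pushforward preimage_bigcup.
apply: measure_semi_sigma_additive.
- by move=> k; exact: mcons.
- apply/trivIsetP => /= i j _ _ ij; rewrite -preimage_setI.
  by move/trivIsetP : tF => /(_ _ _ _ _ ij) ->//; rewrite preimage_set0.
- by rewrite -preimage_bigcup; exact: mcons.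
Qed.

HB.instance Definition _ := isMeasure.Build _ _ _ cons_measure
  cons_measure0 cons_measure_ge0 cons_measure_sigma_additive.

Let uncons_rV (x : 'rV[R]_n.+1) : measurableTypeR R * 'rV[R]_n :=
  (coord_rV ord0 x, \row_j x ord0 (lift ord0 j)).

Let cons_rVK : cancel cons_rV uncons_rV.
Proof.
move=> [a v]; rewrite /uncons_rV /cons_rV /coord_rV /=; congr (_, _).
  by rewrite mxE unlift_none.
by apply/rowP => j; rewrite !mxE liftK.
Qed.

Let measurable_uncons_rV : measurable_fun setT uncons_rV.
Proof.
apply: measurable_fun_pair; first exact: measurable_coord_rV.
apply/measurable_fun_rVP => i.
rewrite (_ : _ \o _ = coord_rV (lift ord0 i)); last first.
  by apply/funext => x; rewrite /= /coord_rV mxE.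
exact: measurable_coord_rV.
Qed.

Let cons_measure_sigma_finite : sigma_finite setT cons_measure.
Proof.
have [F FT mF] : sigma_finite setT (product_measure1 (@lebesgue_measure R) mu).
  have /sigma_finiteP[F [TF ndF Foo]] := sigma_finiteT (@lebesgue_measure R).
  have /sigma_finiteP[G [TG ndG Goo]] := sigma_finiteT mu.
  exists (fun k => F k `*` G k).
    rewrite -setXTT TF TG predeqE => -[x y]; split.
      move=> [/= [k _ Fkx] [l _ Gly]]; exists (maxn k l) => //; split.
      - by move: x Fkx; exact/subsetPset/ndF/leq_maxl.
      - by move: y Gly; exact/subsetPset/ndG/leq_maxr.
    by move=> [k _ []/= ? ?]; split; exists k.
  move=> k; have [? ?] := Foo k; have [? ?] := Goo k.
  split; first exact: measurableX.
  by rewrite product_measure1E// lte_mul_pinfty// ge0_fin_numE.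
exists (fun k => uncons_rV @^-1` F k).
  by rewrite -preimage_bigcup -FT preimage_setT.
move=> k; have [mFk Fkoo] := mF k; split.
  by rewrite -[X in measurable X]setTI; exact: measurable_uncons_rV.
rewrite /cons_measure /pushforward -comp_preimage.
by rewrite (_ : _ \o _ = id) //; apply/funext => p; exact: cons_rVK.
Qed.

HB.instance Definition _ := Measure_isSigmaFinite.Build _ _ _ cons_measure
  cons_measure_sigma_finite.

End cons_measure.

Section lebesgue_rV_measure.
Context {R : realType} (n : nat).

Lemma lebesgue_rV_ex :
  exists mu : {sigma_finite_measure set 'rV[R]_n -> \bar R},
    @lebesgue_rV R n = mu.
Proof.
elim: n => [|k [mu /= ->]]; first by exists (dirac (0 : 'rV[R]_0)).
by exists (cons_measure mu).
Qed.

Let lebesgue_rV0 : @lebesgue_rV R n set0 = 0%E.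
Proof. by have [mu ->] := lebesgue_rV_ex; exact: measure0. Qed.

Let lebesgue_rV_ge0 A : (0 <= @lebesgue_rV R n A)%E.
Proof. by have [mu ->] := lebesgue_rV_ex; exact: measure_ge0. Qed.

Let lebesgue_rV_sigma_additive : semi_sigma_additive (@lebesgue_rV R n).
Proof.
by have [mu ->] := lebesgue_rV_ex; exact: measure_semi_sigma_additive.
Qed.

HB.instance Definition _ := isMeasure.Build _ _ _ (@lebesgue_rV R n)
  lebesgue_rV0 lebesgue_rV_ge0 lebesgue_rV_sigma_additive.

Let lebesgue_rV_sigma_finite : sigma_finite setT (@lebesgue_rV R n).
Proof. by have [mu ->] := lebesgue_rV_ex; exact: sigma_finiteT. Qed.

HB.instance Definition _ := Measure_isSigmaFinite.Build _ _ _
  (@lebesgue_rV R n) lebesgue_rV_sigma_finite.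

End lebesgue_rV_measure.

Section bernstein.
Context {R : realType}.
Implicit Types (Psi : R -> R) (m : {measure set (measurableTypeR R) -> \bar R}).

Definition bernstein Psi :=
  [/\ forall (n : nat) (x : R), 0 < x -> derivable (derive1n n Psi) x 1,
      forall x : R, 0 < x -> 0 <= Psi x &
      forall (n : nat) (x : R), (0 < n)%N -> 0 < x ->
        (-1) ^+ n * derive1n n Psi x <= 0].

(* the class B_0 *)
Definition bernstein0 Psi := bernstein Psi /\ Psi x @[x --> 0^'+] --> (0 : R).

(* Only the restriction of m to (0, +oo) is used, here and in levy_density. *)
Definition zero_drift Psi m :=
  (\int[m]_(y in `]0%R, +oo[) (Num.min y 1)%:E < +oo)%E /\
  forall x : R, 0 < x ->
    (Psi x)%:E = (\int[m]_(y in `]0%R, +oo[) (1 - expR (- (y * x)))%:E)%E.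

Definition levy_density (d : nat) m (r : R) : \bar R :=
  (\int[m]_(t in `]0%R, +oo[)
     (((4 * pi * t) `^ (- (d%:R / 2)) * expR (- (r ^+ 2 / (4 * t))))%:E))%E.

Definition WLSC Psi := exists mu c theta : R,
  [/\ 0 < mu, 0 < c <= 1, 0 <= theta &
      forall x gamma : R, theta < x -> 1 <= gamma ->
        c * gamma `^ mu * Psi x <= Psi (gamma * x)].

End bernstein.

Section domains.
Context {R : realType}.

Definition grad (n : nat) (g : 'rV[R]_n -> R) (x : 'rV[R]_n) : 'rV[R]_n :=
  \row_j 'D_(delta_mx ord0 j) g x.

Definition C11_function (n : nat) (g : 'rV[R]_n -> R) :=
  (forall x, differentiable g x) /\
  exists L : R, forall x y, enorm (grad g x - grad g y) <= L * enorm (x - y).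

(* Near each boundary point z, in orthonormal coordinates y = (x - z) Q, the
   set D is the strict epigraph y_i > g(y_1, .., omit y_i, .., y_d) of a C^{1,1}
   function g. *)
Definition C11_boundary (d : nat) (D : set 'rV[R]_d) :=
  forall z, (closure D `\` interior D) z ->
  exists (r : R) (Q : 'M[R]_d) (i : 'I_d) (g : 'rV[R]_d.-1 -> R),
  [/\ 0 < r, Q *m Q^T = 1%:M, C11_function g &
      forall x, enorm (x - z) < r ->
        let y := (x - z) *m Q in D x <-> g (col' i y) < y ord0 i].

Definition diam (d : nat) (D : set 'rV[R]_d) : R :=
  sup [set enorm (x - y) | x in D & y in D].

Definition sup_norm (d : nat) (D : set 'rV[R]_d) (c : 'rV[R]_d -> R) : R :=
  sup [set `|c x| | x in D].

End domains.

Section viscosity.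
Context {R : realType} (d : nat).
Implicit Types (phi u c h : 'rV[R]_d -> R) (x : 'rV[R]_d).

Definition C2_near phi x :=
  \forall y \near x,
    {for y, continuous phi} /\
    forall i : 'I_d, let di := delta_mx ord0 i in
      [/\ derivable phi y di, {for y, continuous ('D_di phi)} &
          forall j : 'I_d, let dj := delta_mx ord0 j in
            derivable ('D_di phi) y dj /\
            {for y, continuous ('D_dj ('D_di phi))}].

(* the class C_b^2(x) *)
Definition C2b phi x :=
  [/\ measurable_fun setT (phi : 'rV[R]_d -> measurableTypeR R),
      bounded_fun phi & C2_near phi x].

(* - Psi(- Delta) phi (x), where m is the Levy measure of Psi *)
Definition nonlocal_op (m : {measure set (measurableTypeR R) -> \bar R})
    phi x : \bar R :=
  ((2^-1)%:E * \int[@lebesgue_rV R d]_z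
     ((phi (x + z) + phi (x - z) - 2 * phi x)%:E *
      levy_density d m (enorm z)))%E.

(* - Psi(- Delta) u + c u >= h in D *)
Definition viscosity_subsolution
    (m : {measure set (measurableTypeR R) -> \bar R}) (D : set 'rV[R]_d)
    c h u :=
  forall x phi, D x -> C2b phi x -> phi x = u x ->
    (forall y, y != x -> u y < phi y) ->
    ((h x)%:E <= nonlocal_op m phi x + (c x * u x)%:E)%E.

End viscosity.

(* Main.v *)
Require Import Defs.
From mathcomp Require Import all_boot all_order all_algebra.
From mathcomp Require Import all_classical all_reals all_analysis.
From mathcomp Require Import measurable_realfun ring lra.

Set Implicit Arguments.
Unset Strict Implicit.
Unset Printing Implicit Defensive.

Import Order.TTheory GRing.Theory Num.Theory.
Import numFieldNormedType.Exports.

Local Open Scope classical_set_scope.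
Local Open Scope ring_scope.

(* If M = max u were positive, it would be attained at some x0 in D. Touch u
   from above at x0 by the function equal to M plus a flat, even bump of size
   eta near x0, to M + eta on the rest of D and to eta off D. Its nonlocal
   operator at x0 is at most O(eta) - (M - eta) I, where I is the integral of
   the jump kernel j over the z with |z| >= rho and x0 + z, x0 - z both outside
   D. WLSC makes Psi unbounded, so the Levy measure is infinite near 0 and so is
   the integral of j near the origin (estimated on dyadic shells); since j is
   bounded away from 0, removing a set of small Lebesgue measure costs little,
   and I >= |c|_oo + 1 as soon as rho and |D| are small, uniformly in x0. Letting
   eta be small contradicts the sub-solution inequality. Only the size of c
   enters the choice of the threshold. *)

(** * Lebesgue measure on R^n *)

Section lebesgue_rV_theory.
Context {R : realType}.

Lemma measurable_coord_preimage (n : nat) (i : 'I_n) (B : set R) :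
  measurable B -> measurable [set x : 'rV[R]_n | B (x ord0 i)].
Proof.
by move=> mB; have := measurable_coord_rV i measurableT mB; rewrite setTI.
Qed.

Lemma measurable_box (n : nat) (B : 'I_n -> set R) :
  (forall i, measurable (B i)) ->
  measurable [set x : 'rV[R]_n | forall i, B i (x ord0 i)].
Proof.
move=> mB; have -> : [set x : 'rV[R]_n | forall i, B i (x ord0 i)] =
    \big[setI/setT]_(i < n) [set x : 'rV[R]_n | B i (x ord0 i)].
  apply/seteqP; split => x /=.
    by move=> Bx; rewrite -bigcap_seq => i _; exact: Bx.
  by rewrite -bigcap_seq => Bx i; apply: Bx => /=; rewrite mem_index_enum.
by apply: bigsetI_measurable => i _; exact: measurable_coord_preimage.
Qed.

Lemma normr_coord_le (n : nat) (x : 'rV[R]_n) (i : 'I_n) : `|x ord0 i| <= `|x|.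
Proof.
rewrite [leRHS]/Num.norm/= mx_normrE.
by apply: (le_bigmax _ (fun ij => `|x ij.1 ij.2|) (ord0, i)).
Qed.

Lemma normr_lt_coord (n : nat) (x : 'rV[R]_n) (r : R) : 0 < r ->
  (`|x| < r) <-> (forall i, `|x ord0 i| < r).
Proof.
move=> r0; split=> [xr i|xr]; first exact: le_lt_trans (normr_coord_le _ _) xr.
rewrite [ltLHS]/Num.norm/= mx_normrE; apply: bigmax_lt => // -[i j] _ /=.
by rewrite ord1.
Qed.

Lemma in_itv_center (x y e : R) :
  (x \in `]y - e, y + e[) = (y \in `]x - e, x + e[).
Proof. by rewrite !in_itv/=; apply/idP/idP => /andP[? ?]; apply/andP; split; lra. Qed.

Lemma open_measurable_rV (n : nat) (A : set 'rV[R]_n) :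
  open A -> measurable A.
Proof.
move=> oA.
pose box (p : 'rV[rat]_n * nat) : set 'rV[R]_n :=
  [set x | forall i, x ord0 i \in `]ratr (p.1 ord0 i) - p.2.+1%:R^-1,
                                    ratr (p.1 ord0 i) + p.2.+1%:R^-1[].
have -> : A = \bigcup_p (if `[< box p `<=` A >] then box p else set0).
  apply/seteqP; split=> [x Ax|x [p _]]; last by case: asboolP => // boxA /boxA.
  have : nbhs x A by move: oA; rewrite openE => /(_ _ Ax).
  rewrite -nbhs_ballE => -[e /= e0 xeA].
  have [k _ /(_ k (leqnn k)) /= ke] : \forall k \near \oo, (k.+1%:R^-1 < e / 2 :> R).
    by apply: near_infty_natSinv_lt (PosNum (divr_gt0 e0 (ltr0Sn _ 1))).
  have hq i : exists q : rat, ratr q \in `]x ord0 i - k.+1%:R^-1, x ord0 i + k.+1%:R^-1[.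
    apply: rat_in_itvoo; rewrite ltrBlDr -addrA ltrDl.
    by rewrite addr_gt0// invr_gt0.
  have [q qP] := choice hq.
  exists (\row_i q i, k) => //=; case: asboolP => [_ i|]/=.
    by have := qP i; rewrite in_itv_center mxE.
  case=> y boxy; apply: xeA => /=; split => // i j; rewrite ord1.
  have := boxy j; have := qP j; rewrite /= !in_itv/= mxE /ball/= ltr_norml.
  move: (ratr _) k.+1%:R^-1 ke => q' e' ke.
  by move=> /andP[? ?] /andP[? ?]; apply/andP; split; lra.
apply: countable_bigcupT_measurable => [|p]; first exact: countableP.
case: asboolP => // _.
apply: (@measurable_box _ (fun i => [set` `]ratr (p.1 ord0 i) - p.2.+1%:R^-1,
                                  ratr (p.1 ord0 i) + p.2.+1%:R^-1[])) => i.
exact: measurable_itv.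
Qed.

Lemma lebesgue_measure_affine (b sg : R) (B : set R) : sg = 1 \/ sg = -1 ->
  measurable B ->
  lebesgue_measure [set a : R | B (b + sg * a)] = lebesgue_measure B.
Proof.
move=> sgE mB.
have mf : measurable_fun setT
    (fun a : measurableTypeR R => b + sg * a : measurableTypeR R).
  by apply: measurable_funD => //; exact: measurable_funM.
have itvE (a c : R) : lebesgue_measure [set x : R | b + sg * x \in `]a, c]] =
    lebesgue_measure (`]a, c]%classic : set R).
  case: sgE => ->.
    rewrite (_ : [set x | _] = `]a - b, c - b]%classic).
      by rewrite !lebesgue_measure_itv/= !lte_fin ltrD2r;
        case: ifPn => // _; congr (_%:E); lra.
    by apply/seteqP; split => x /=; rewrite !in_itv/= => /andP[? ?];
      apply/andP; split; lra.
  rewrite (_ : [set x | _] = `[b - c, b - a[%classic).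
    rewrite !lebesgue_measure_itv/= !lte_fin ltrD2l ltrN2.
    by case: ifPn => // _; congr (_%:E); lra.
  by apply/seteqP; split => x /=; rewrite !in_itv/= => /andP[? ?];
      apply/andP; split; lra.
apply/esym/(@lebesgue_measure_unique _ (pushforward lebesgue_measure
  (fun a : measurableTypeR R => b + sg * a : measurableTypeR R))) => // _ [[a c]] _ <-.
by rewrite -itvE.
Qed.

End lebesgue_rV_theory.

Section lebesgue_rV_invariance.
Context {R : realType}.

Lemma measurable_affine_rV (n : nat) (x : 'rV[R]_n) (sg : R) :
  measurable_fun setT (fun z : 'rV[R]_n => x + sg *: z).
Proof.
apply/measurable_fun_rVP => i.
rewrite (_ : _ \o _ = fun z => x ord0 i + sg * coord_rV i z); last first.
  by apply/funext => z; rewrite /= /coord_rV !mxE.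
apply: measurable_funD => //; apply: measurable_funM => //.
exact: measurable_coord_rV.
Qed.

Lemma lebesgue_rVS (n : nat) (A : set 'rV[R]_n.+1) :
  lebesgue_rV A = product_measure1 (@lebesgue_measure R) (@lebesgue_rV R n)
    (cons_rV @^-1` A).
Proof. by []. Qed.

Lemma measurable_cons_preimage (n : nat) (A : set 'rV[R]_n.+1) :
  measurable A -> measurable (@cons_rV R n @^-1` A).
Proof.
by move=> mA; rewrite -[X in measurable X]setTI; exact: measurable_cons_rV.
Qed.

Lemma lebesgue_rV_affine (n : nat) (x : 'rV[R]_n) (sg : R) (A : set 'rV[R]_n) :
  sg = 1 \/ sg = -1 -> measurable A ->
  lebesgue_rV [set z | A (x + sg *: z)] = lebesgue_rV A.
Proof.
move=> sgE; elim: n x A => [|n IHn] x A mA.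
  rewrite (_ : [set z | _] = A) //; apply/seteqP.
  by split=> z /=; rewrite [x + _]thinmx0 [z]thinmx0.
rewrite !lebesgue_rVS.
pose x' : 'rV[R]_n := \row_j x ord0 (lift ord0 j).
pose f (p : measurableTypeR R * 'rV[R]_n) : measurableTypeR R * 'rV[R]_n :=
  (x ord0 ord0 + sg * p.1, x' + sg *: p.2).
have mf : measurable_fun setT f.
  apply: measurable_fun_pair.
    by apply: measurable_funD => //; apply: measurable_funM => //.
  exact: (measurableT_comp (measurable_affine_rV x' sg) measurable_snd).
have -> : cons_rV @^-1` [set z | A (x + sg *: z)] = f @^-1` (cons_rV @^-1` A).
  have E p : x + sg *: cons_rV p = cons_rV (f p).
    apply/rowP => i; rewrite !mxE; case: (unliftP ord0 i) => [j|] -> /=.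
      by rewrite !mxE.
    by [].
  by apply/seteqP; split => p /=; rewrite E.
apply/esym/(@product_measure_unique _ _ _ _ _ lebesgue_measure (@lebesgue_rV R n)
  (pushforward (product_measure1 lebesgue_measure (@lebesgue_rV R n)) f)); last first.
  exact: measurable_cons_preimage.
move=> B C mB mC.
transitivity (product_measure1 lebesgue_measure (@lebesgue_rV R n)
  (f @^-1` (B `*` C))) => //.
have -> : f @^-1` (B `*` C) =
    [set a | B (x ord0 ord0 + sg * a)] `*` [set z | C (x' + sg *: z)].
  by apply/seteqP; split => p.
rewrite product_measure1E.
- transitivity (lebesgue_measure [set a : R | B (x ord0 ord0 + sg * a)%R] *
                lebesgue_rV [set z : 'rV[R]_n | C (x' + sg *: z)%R])%E => //.
  by rewrite IHn// lebesgue_measure_affine.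
- have mg : measurable_fun setT
      (fun a : measurableTypeR R => x ord0 ord0 + sg * a : measurableTypeR R).
    by apply: measurable_funD => //; exact: measurable_funM.
  by have := mg measurableT _ mB; rewrite setTI.
- by have := measurable_affine_rV x' sg measurableT mC; rewrite setTI.
Qed.

Lemma lebesgue_rV_box (n : nat) (B : set R) (l : R) :
  measurable B -> lebesgue_measure B = l%:E ->
  lebesgue_rV [set z : 'rV[R]_n | forall i, B (z ord0 i)] = (l ^+ n)%:E.
Proof.
move=> mB Bl; elim: n => [|n IHn].
  rewrite expr0 /= diracE mem_set//=; by case.
rewrite lebesgue_rVS.
have -> : cons_rV @^-1` [set z : 'rV[R]_n.+1 | forall i, B (z ord0 i)] =
    B `*` [set z : 'rV[R]_n | forall i, B (z ord0 i)].
  apply/seteqP; split => -[a z] /=.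
    move=> Bz; split; first by have := Bz ord0; rewrite mxE unlift_none.
    by move=> i; have := Bz (lift ord0 i); rewrite mxE liftK.
  move=> [Ba Bz] i; rewrite mxE; case: unliftP => [j|] _ //=.
rewrite product_measure1E//; last exact: (@measurable_box _ _ (fun=> B)).
by rewrite exprS EFinM; congr (_ * _)%E.
Qed.

Lemma ball_measurable_rV (n : nat) (r : R) :
  measurable [set z : 'rV[R]_n | `|z| < r].
Proof.
have [r0|r0] := ltP 0 r; last first.
  rewrite (_ : [set z | _] = set0)//; apply/seteqP; split => // z /=.
  by move=> /(le_lt_trans (normr_ge0 _)); rewrite ltNge r0.
rewrite (_ : [set z | _] = [set z : 'rV[R]_n | forall i, `|z ord0 i| < r]).
  apply: (@measurable_box _ n (fun=> [set a | `|a| < r])) => _.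
  rewrite (_ : [set a | _] = `](-r), r[%classic)//.
  by apply/seteqP; split => a /=; rewrite in_itv/= ltr_norml.
by apply/seteqP; split => z /=; rewrite normr_lt_coord.
Qed.

Lemma lebesgue_rV_ball (n : nat) (r : R) : 0 < r ->
  lebesgue_rV [set z : 'rV[R]_n | `|z| < r] = ((2 * r) ^+ n)%:E.
Proof.
move=> r0.
rewrite (_ : [set z | _] = [set z : 'rV[R]_n | forall i, `](-r), r[%classic (z ord0 i)]).
  apply: lebesgue_rV_box => //; rewrite lebesgue_measure_itv/= lte_fin.
  by rewrite ifT; [congr (_%:E); lra|lra].
by apply/seteqP; split => z /=; rewrite normr_lt_coord// => zr i; have := zr i;
  rewrite in_itv/= ltr_norml.
Qed.

End lebesgue_rV_invariance.

(** * The Levy density *)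

Section levy_density_theory.
Context {R : realType}.

Definition heat_kernel (d : nat) (t r : R) : R :=
  (4 * pi * t) `^ (- (d%:R / 2)) * expR (- (r ^+ 2 / (4 * t))).

Lemma heat_kernel_ge0 (d : nat) (t r : R) : 0 <= heat_kernel d t r.
Proof. by rewrite mulr_ge0 ?powR_ge0 ?expR_ge0. Qed.

Lemma le_heat_kernel (d : nat) (t a r : R) :
  0 < t -> `|a| <= `|r| -> heat_kernel d t r <= heat_kernel d t a.
Proof.
move=> t0 ar; rewrite ler_wpM2l ?powR_ge0// ler_expR lerN2.
rewrite ler_pM2r ?invr_gt0; last by rewrite mulr_gt0.
by rewrite -[leLHS]real_normK ?num_real// -[leRHS]real_normK ?num_real// lerXn2r ?nnegrE.
Qed.

Lemma le0r_powRN (s x y : R) :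
  0 <= s -> 0 < x -> x <= y -> y `^ (- s) <= x `^ (- s).
Proof.
move=> s0 x0 xy; have y0 := lt_le_trans x0 xy.
rewrite !powRN lef_pV2 ?posrE ?powR_gt0//.
by apply: ge0_ler_powR => //; rewrite nnegrE ltW.
Qed.

Lemma measurable_heat_kernel (d : nat) (r : R) :
  measurable_fun (`]0, +oo[%classic : set (measurableTypeR R))
    (fun t => heat_kernel d t r : measurableTypeR R).
Proof.
apply: (@eq_measurable_fun _ _ _ _ _ (fun t : measurableTypeR R =>
  (4 * pi * t) `^ (- (d%:R / 2)) * expR (- (r ^+ 2 / 4 * t `^ (-1))))).
  move=> t; rewrite inE/= in_itv/= andbT => t0.
  by rewrite /heat_kernel powR_inv1 ?(ltW t0)// invfM mulrA.
apply: measurable_funTS; apply: measurable_funM.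
  apply: (measurableT_comp (measurable_powR _)).
  exact: measurable_funM.
apply: (measurableT_comp (@measurable_expR R)); apply: measurableT_comp => //.
by apply: measurable_funM => //; exact: measurable_powR.
Qed.

Lemma expr_le_expR (n : nat) (s : R) : 0 <= s -> s ^+ n <= n`!%:R * expR s.
Proof.
move=> s0; case: n => [|n].
  by rewrite expr0 fact0 mul1r; have := expR_ge1Dx s; lra.
rewrite mulrC -ler_pdivrMr ?ltr0n ?fact_gt0//.
by have := expR_ge1Dxn n s0; lra.
Qed.

Lemma pi4_ge1 : 1 <= 4 * pi :> R.
Proof. by have := @pi_ge2 R; lra. Qed.

(* For t >= 1 the kernel is at most 1; for t <= 1 the factor t^(-d) coming from
   the prefactor is absorbed by exp(-s) <= (d+1)! s^(-d-1), s = r^2/(4t), which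
   leaves one power of t to spare. *)
Lemma heat_kernel_bound (d : nat) (t r r0 : R) : 0 < t -> 0 <= r <= r0 ->
  r ^+ (2 * d.+1) * heat_kernel d t r <=
  (r0 ^+ (2 * d.+1) + 2 * (4 ^+ d.+1 * d.+1`!%:R)) * Num.min t 1.
Proof.
move=> t0 /andP[r_ge0 rr0].
have c0 : 0 <= 2 * (4 ^+ d.+1 * d.+1`!%:R) :> R by rewrite !mulr_ge0 ?exprn_ge0.
have r00 : 0 <= r0 ^+ (2 * d.+1) by rewrite exprn_ge0// (le_trans r_ge0).
have dge0 : 0 <= d%:R / 2 :> R by rewrite divr_ge0.
have e1 : expR (- (r ^+ 2 / (4 * t))) <= 1.
  by rewrite expR_le1 oppr_le0 divr_ge0 ?sqr_ge0// mulr_ge0// ltW.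
have [t1|t1] := leP 1 t.
  rewrite mulr1.
  apply: (@le_trans _ _ (r0 ^+ (2 * d.+1))); last by rewrite lerDl.
  rewrite -[leRHS]mulr1 ler_pM ?exprn_ge0 ?heat_kernel_ge0//.
    by rewrite lerXn2r ?nnegrE// (le_trans r_ge0).
  rewrite -[leRHS]mulr1 ler_pM ?powR_ge0 ?expR_ge0//.
  apply: (le_trans (le0r_powRN dge0 ltr01 _)); last by rewrite powR1.
  by have := pi4_ge1; nra.
have pre : (4 * pi * t) `^ (- (d%:R / 2)) <= (t ^+ d)^-1.
  apply: (@le_trans _ _ (t `^ (- (d%:R / 2)))).
    by rewrite le0r_powRN//; have := pi4_ge1; nra.
  rewrite -(powR_mulrn d (ltW t0)) powRN lef_pV2 ?posrE ?powR_gt0//.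
  apply: ger_powR; first by rewrite t0 ltW.
  by rewrite ler_pdivrMr// ler_peMr//; lra.
have s0 : 0 <= r ^+ 2 / (4 * t) by rewrite divr_ge0 ?sqr_ge0// mulr_ge0// ltW.
have := expr_le_expR d.+1 s0; rewrite expr_div_n -exprM => es.
apply: (@le_trans _ _ ((4 ^+ d.+1 * d.+1`!%:R) * t)); last first.
  by rewrite ler_pM2r//; lra.
apply: (@le_trans _ _ (r ^+ (2 * d.+1) * ((t ^+ d)^-1 * expR (- (r ^+ 2 / (4 * t)))))).
  by rewrite ler_wpM2l ?exprn_ge0// ler_wpM2r// expR_ge0.
rewrite expRN mulrCA ler_pdivrMl ?exprn_gt0// ler_pdivrMr ?expR_gt0//.
move: es; rewrite ler_pdivrMr; last by rewrite exprn_gt0// mulr_gt0.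
move=> /le_trans; apply; rewrite exprMn [t ^+ d.+1]exprS le_eqVlt.
by apply/orP; left; apply/eqP; ring.
Qed.

Variables (d : nat) (m : {measure set (measurableTypeR R) -> \bar R}).

Lemma levy_densityE (r : R) :
  levy_density d m r = (\int[m]_(t in `]0%R, +oo[) (heat_kernel d t r)%:E)%E.
Proof. by []. Qed.

Lemma levy_density_ge0 (r : R) : (0 <= levy_density d m r)%E.
Proof. by apply: integral_ge0 => t _; rewrite lee_fin heat_kernel_ge0. Qed.

Lemma le_levy_density (a r : R) : `|a| <= `|r| ->
  (levy_density d m r <= levy_density d m a)%E.
Proof.
move=> ar; rewrite !levy_densityE; apply: ge0_le_integral => //.
- by move=> t _; rewrite lee_fin heat_kernel_ge0.
- by apply/measurable_EFinP; exact: measurable_heat_kernel.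
- by apply/measurable_EFinP; exact: measurable_heat_kernel.
- move=> t /=; rewrite in_itv/= andbT => t0.
  by rewrite lee_fin le_heat_kernel.
Qed.

Lemma measurable_levy_density :
  measurable_fun (setT : set (measurableTypeR R)) (levy_density d m).
Proof.
apply: (measurability _ (ErealGenOInfty.measurableE R)).
move=> _ [_ [y ->]] <-; rewrite setTI; apply: is_interval_measurable => a b /=.
rewrite !in_itv/= !andbT => ya yb c /andP[ac cb]; rewrite in_itv/= andbT.
have [c0|c0] := leP 0 c.
  apply: lt_le_trans yb (le_levy_density _).
  by rewrite ger0_norm// (le_trans cb)// ler_norm.
apply: lt_le_trans ya (le_levy_density _).
by rewrite ltr0_norm// -(normrN a) (le_trans _ (ler_norm _))// lerN2.
Qed.

Lemma enorm_ge0 (n : nat) (z : 'rV[R]_n) : 0 <= enorm z.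
Proof. exact: sqrtr_ge0. Qed.

Lemma sqr_enorm (n : nat) (z : 'rV[R]_n) :
  enorm z ^+ 2 = \sum_(i < n) z ord0 i ^+ 2.
Proof. by rewrite sqr_sqrtr// sumr_ge0// => i _; exact: sqr_ge0. Qed.

Lemma normr_coord_le_enorm (n : nat) (z : 'rV[R]_n) (i : 'I_n) :
  `|z ord0 i| <= enorm z.
Proof.
rewrite -(@ler_pXn2r _ 2) ?nnegrE ?enorm_ge0// sqr_enorm real_normK ?num_real//.
by rewrite (bigD1 i)//= lerDl sumr_ge0// => j _; exact: sqr_ge0.
Qed.

Lemma normr_le_enorm (n : nat) (z : 'rV[R]_n) : `|z| <= enorm z.
Proof.
rewrite [leLHS]/Num.norm/= mx_normrE; apply: bigmax_le => [|[i j] _ /=].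
  exact: enorm_ge0.
by rewrite ord1 normr_coord_le_enorm.
Qed.

Lemma measurable_enorm (n : nat) :
  measurable_fun setT (fun z : 'rV[R]_n => enorm z : measurableTypeR R).
Proof.
rewrite (_ : (fun z => _) =
    (fun z : 'rV[R]_n => (\sum_(i < n) coord_rV i z ^+ 2) `^ (2^-1))); last first.
  apply/funext => z; rewrite powR12_sqrt// sumr_ge0// => i _; exact: sqr_ge0.
apply: (measurableT_comp (measurable_powR _)); apply: measurable_sum => i.
by apply: measurable_funX; exact: measurable_coord_rV.
Qed.

Lemma measurable_levy_enorm (n : nat) :
  measurable_fun setT (fun z : 'rV[R]_n => levy_density d m (enorm z)).
Proof. exact: (measurableT_comp measurable_levy_density (@measurable_enorm n)). Qed.

End levy_density_theory.

Section levy_mass.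
Context {R : realType}.
Variable m : {measure set (measurableTypeR R) -> \bar R}.

Definition box (n : nat) (a b : R) : set 'rV[R]_n :=
  [set z | forall i, z ord0 i \in `[a, b[].

Lemma measurable_box_itv (n : nat) (a b : R) : measurable (@box n a b).
Proof.
by apply: (@measurable_box _ n (fun=> `[a, b[%classic)) => _; exact: measurable_itv.
Qed.

Definition shell_mass (d : nat) : R := (16 * pi) `^ (- (d%:R / 2)) * expR (- d%:R).

Lemma shell_mass_gt0 (d : nat) : 0 < shell_mass d.
Proof. by rewrite mulr_gt0 ?expR_gt0// powR_gt0// mulr_gt0 ?pi_gt0. Qed.

Lemma heat_kernel_shell (d : nat) (a t : R) (z : 'rV[R]_d) : 0 < a ->
  box a (2 * a) z -> t \in `[a ^+ 2, (2 * a) ^+ 2[ ->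
  shell_mass d / a ^+ d <= heat_kernel d t (enorm z).
Proof.
move=> a0 boxz; rewrite in_itv/= => /andP[at1 ta].
have a20 : 0 < a ^+ 2 by rewrite exprn_gt0.
have t0 : 0 < t := lt_le_trans a20 at1.
have z4 : enorm z ^+ 2 <= d%:R * (2 * a) ^+ 2.
  rewrite sqr_enorm mulr_natl -[X in _ *+ X]card_ord -sumr_const.
  apply: ler_sum => i _; have := boxz i; rewrite in_itv/= => /andP[? ?]; nra.
have dge0 : 0 <= d%:R / 2 :> R by rewrite divr_ge0.
have -> : shell_mass d / a ^+ d =
    (16 * pi * a ^+ 2) `^ (- (d%:R / 2)) * expR (- d%:R).
  rewrite /shell_mass [(_ * a ^+ 2) `^ _]powRM ?(ltW a20)//; last first.
    by rewrite mulr_ge0 ?pi_ge0.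
  rewrite -!mulrA; congr (_ * _).
  rewrite mulrC; congr (_ * _).
  rewrite -(powR_mulrn 2 (ltW a0)) -powRrM -(powR_mulrn d (ltW a0)) -powRN.
  by congr (_ `^ _); field.
apply: ler_pM; rewrite ?powR_ge0 ?expR_ge0//.
  by rewrite le0r_powRN ?mulr_gt0 ?pi_gt0//; have := @pi_gt0 R; nra.
rewrite ler_expR lerN2 ler_pdivrMr ?mulr_gt0//.
by apply: (le_trans z4); rewrite ler_wpM2l//; nra.
Qed.

Lemma levy_shell (d : nat) (a : R) : 0 < a ->
  ((shell_mass d)%:E * m `[(a ^+ 2)%R, ((2 * a) ^+ 2)%R[%classic <=
   \int[@lebesgue_rV R d]_(z in box a (2 * a)%R) levy_density d m (enorm z))%E.
Proof.
move=> a0; set T := `[_, _[%classic.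
have a20 : 0 < a ^+ 2 by rewrite exprn_gt0.
have low (z : 'rV[R]_d) : box a (2 * a) z ->
    ((shell_mass d / a ^+ d)%:E * m T <= levy_density d m (enorm z))%E.
  move=> boxz.
  have mT : measurable (T : set (measurableTypeR R)) by exact: measurable_itv.
  rewrite -(integral_cst m mT) levy_densityE.
  have TS : T `<=` `]0, +oo[%classic.
    by move=> t /=; rewrite !in_itv/= andbT => /andP[/(lt_le_trans a20)].
  apply: (@le_trans _ _ (\int[m]_(t in T) (heat_kernel d t (enorm z))%:E)%E).
    apply: ge0_le_integral => //.
    - by move=> t _; rewrite lee_fin divr_ge0 ?exprn_ge0 ?ltW ?shell_mass_gt0.
    - apply: (measurable_funS _ TS) => //.
      by apply/measurable_EFinP; exact: measurable_heat_kernel.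
    - by move=> t Tt; rewrite /= lee_fin (heat_kernel_shell a0 boxz).
  apply: ge0_subset_integral => //.
    by apply/measurable_EFinP; exact: measurable_heat_kernel.
  by move=> t _; rewrite lee_fin heat_kernel_ge0.
have -> : ((shell_mass d)%:E * m T =
    (shell_mass d / a ^+ d)%:E * m T * @lebesgue_rV R d (box a (2 * a)%R))%E.
  rewrite (@lebesgue_rV_box _ d `[a, 2 * a[%classic a)//; last first.
    rewrite lebesgue_measure_itv/= lte_fin ifT; last by lra.
    by congr (_%:E); ring.
  rewrite muleAC -EFinM divfK// gt_eqF// exprn_gt0//.
have mbox := @measurable_box_itv d a (2 * a).
rewrite -(integral_cst _ mbox).
apply: ge0_le_integral => //.
- by move=> z _; rewrite mule_ge0// lee_fin divr_ge0 ?exprn_ge0 ?ltW ?shell_mass_gt0.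
- by apply: measurable_funTS; exact: measurable_levy_enorm.
Qed.

Lemma levy_dyadic_shells (d n : nat) : (0 < d)%N ->
  ((shell_mass d)%:E * m `[((2^-1 ^+ n) ^+ 2)%R, 1%R[%classic <=
   \int[@lebesgue_rV R d]_(z in box (2^-1 ^+ n)%R 1%R) levy_density d m (enorm z))%E.
Proof.
move=> d0; elim: n => [|n IHn].
  rewrite expr0 expr1n set_itvco0 measure0 mule0.
  by apply: integral_ge0 => z _; exact: levy_density_ge0.
set a := 2^-1 ^+ n.+1; have a0 : 0 < a by rewrite exprn_gt0.
have aE : 2^-1 ^+ n = 2 * a by rewrite /a exprS; field.
have a1 : 2 * a <= 1 by rewrite -aE exprn_ile1// invr_le1 ?unitfE//; lra.
rewrite aE in IHn.
have k0 := ltW (shell_mass_gt0 d).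
apply: (@le_trans _ _ ((shell_mass d)%:E *
    (m `[(a ^+ 2)%R, ((2 * a) ^+ 2)%R[%classic + m `[((2 * a) ^+ 2)%R, 1%R[%classic))%E).
  rewrite lee_wpmul2l ?lee_fin//; apply: le_trans (measureU2 _ _ _) => //.
  rewrite le_measure ?inE//; first exact: measurableU.
  move=> t /=; rewrite !in_itv/= => /andP[at1 t1].
  by have [t2|t2] := ltP t ((2 * a) ^+ 2); [left|right]; rewrite /= ?at1 ?t1.
rewrite ge0_muleDr//.
apply: (le_trans (leeD (levy_shell d a0) IHn)).
have mlev (A : set 'rV[R]_d) :
    measurable_fun A (fun z => levy_density d m (enorm z)).
  by apply: measurable_funTS; exact: measurable_levy_enorm.
have mbox (b c : R) : measurable (@box d b c) by exact: measurable_box_itv.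
rewrite -ge0_integral_setU//; first last.
- apply/disj_setPS => z [/(_ (Ordinal d0)) + /(_ (Ordinal d0))].
  by rewrite !in_itv/= => /andP[_ ?] /andP[? _]; lra.
- by move=> z _; exact: levy_density_ge0.
apply: ge0_subset_integral => //.
- exact: measurableU.
- by move=> z _; exact: levy_density_ge0.
- by move=> z [] boxz i; have := boxz i; rewrite !in_itv/= => /andP[? ?]; lra.
Qed.

End levy_mass.

Section infinite_levy_measure.
Context {R : realType}.
Variables (d : nat) (Psi : R -> R).
Variable m : {measure set (measurableTypeR R) -> \bar R}.
Hypothesis Psi_m : zero_drift Psi m.

Let minf : measurable_fun (`]0, +oo[%classic : set (measurableTypeR R))
  (fun y : measurableTypeR R => (Num.min y 1)%:E).
Proof. by apply/measurable_EFinP; exact: measurable_minr. Qed.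

Let min_ge0 (y : R) : y \in `]0, +oo[ -> (0 <= (Num.min y 1)%:E)%E.
Proof.
by rewrite in_itv/= andbT lee_fin le_min => /ltW ->/=.
Qed.

Lemma levy_mass1_ge0 : (0 <= \int[m]_(y in `]0%R, +oo[) (Num.min y 1)%:E)%E.
Proof. by apply: integral_ge0 => y; exact: min_ge0. Qed.

Lemma levy_mass1_fin :
  (\int[m]_(y in `]0%R, +oo[) (Num.min y 1)%:E)%E \is a fin_num.
Proof.
by case: Psi_m => moo _; rewrite ge0_fin_numE//; exact: levy_mass1_ge0.
Qed.

Lemma levy_density_le (r r0 : R) : 0 <= r <= r0 ->
  ((r ^+ (2 * d.+1))%:E * levy_density d m r <=
   (r0 ^+ (2 * d.+1) + 2 * (4 ^+ d.+1 * d.+1`!%:R))%:E *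
   \int[m]_(y in `]0%R, +oo[) (Num.min y 1)%:E)%E.
Proof.
move=> /[dup] rr0 /andP[r_ge0 rler0].
rewrite levy_densityE -!ge0_integralZl//; first last.
- by rewrite lee_fin exprn_ge0.
- by move=> t _; rewrite lee_fin heat_kernel_ge0.
- by apply/measurable_EFinP; exact: measurable_heat_kernel.
- rewrite lee_fin addr_ge0 ?mulr_ge0 ?exprn_ge0//.
  exact: le_trans rler0.
apply: ge0_le_integral => //.
- by move=> t _; rewrite lee_fin mulr_ge0 ?exprn_ge0 ?heat_kernel_ge0.
- apply/measurable_EFinP; apply: measurable_funM => //.
  exact: measurable_heat_kernel.
- by apply/measurable_EFinP; apply: measurable_funM => //; exact: measurable_minr.
- move=> t /=; rewrite in_itv/= andbT => t0.
  by rewrite -EFinM lee_fin heat_kernel_bound.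
Qed.

Let measurable_bern (x : R) :
  measurable_fun (`]0, +oo[%classic : set (measurableTypeR R))
    (fun y : measurableTypeR R => (1 - expR (- (y * x)))%:E).
Proof.
apply/measurable_EFinP; apply: measurable_funB => //.
apply: (measurableT_comp (@measurable_expR R)); apply: measurableT_comp => //.
exact: measurable_funM.
Qed.

Let bern_ge0 (x y : R) : 0 < x -> 0 < y -> 0 <= 1 - expR (- (y * x)).
Proof. by move=> x0 y0; rewrite subr_ge0 expR_le1 oppr_le0 mulr_ge0 ?ltW. Qed.

(* from e^(-s) <= 1/(1+s) with s = yx *)
Let min_le_bern (x y : R) : 0 < x -> 0 < y ->
  Num.min y 1 <= (1 + x) / x * (1 - expR (- (y * x))).
Proof.
move=> x0 y0; have s0 : 0 < y * x by rewrite mulr_gt0.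
have es : (y * x) / (1 + y * x) <= 1 - expR (- (y * x)).
  have -> : (y * x) / (1 + y * x) = 1 - (1 + y * x)^-1 by field; lra.
  rewrite lerD2l lerN2 expRN lef_pV2 ?posrE ?expR_gt0 ?expR_ge1Dx//; lra.
apply: (@le_trans _ _ ((1 + x) / x * ((y * x) / (1 + y * x)))); last first.
  by rewrite ler_wpM2l// divr_ge0//; lra.
have -> : (1 + x) / x * ((y * x) / (1 + y * x)) = y * (1 + x) / (1 + y * x).
  by field; lra.
rewrite ler_pdivlMr; last by lra.
by rewrite minElt; case: ifPn => [|/negP]; rewrite -?leNgt; nra.
Qed.

Lemma Psi_gt0 (x : R) : 0 < x -> (0 < levy_density d m 1)%E -> 0 < Psi x.
Proof.
move=> x0 j1; have [_ /(_ x x0) PsiE] := Psi_m.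
have Psi0 : 0 <= Psi x.
  rewrite -lee_fin PsiE; apply: integral_ge0 => y /=.
  by rewrite in_itv/= andbT lee_fin => y0; exact: bern_ge0.
rewrite lt_neqAle Psi0 andbT; apply/eqP => Psix0.
have le1 : (0 : R) <= 1 <= (1 : R) by apply/andP; split; [exact: ler01|exact: lexx].
have := levy_density_le le1; rewrite expr1n mul1e leNgt => /negP; apply.
apply: le_lt_trans j1.
suff : (\int[m]_(y in `]0%R, +oo[) (Num.min y 1)%:E <= 0)%E.
  move=> min0; rewrite (_ : integral _ _ _ = 0%E) ?mule0//.
  by apply/eqP; rewrite eq_le min0 levy_mass1_ge0.
have c0 : 0 <= (1 + x) / x by rewrite divr_ge0//; lra.
apply: (@le_trans _ _ (((1 + x) / x)%:E * (Psi x)%:E)%E); last by rewrite -Psix0 mule0.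
rewrite PsiE -ge0_integralZl//; last first.
  by move=> y /=; rewrite in_itv/= andbT lee_fin => y0; exact: bern_ge0.
apply: ge0_le_integral => //.
- by apply: measurable_funeM; exact: measurable_bern.
- move=> y /=; rewrite in_itv/= andbT => y0.
  by rewrite -EFinM lee_fin min_le_bern.
Qed.

Lemma Psi_le (x : R) : 0 < x ->
  ((Psi x)%:E <= m `]0%R, 1%R[%classic +
     \int[m]_(y in `]0%R, +oo[) (Num.min y 1)%:E)%E.
Proof.
move=> x0; have [_ /(_ x x0) ->] := Psi_m.
have mI : measurable (`]0, 1[%classic : set (measurableTypeR R)) by exact: measurable_itv.
have mS : measurable (`]0, +oo[%classic : set (measurableTypeR R)).
  exact: measurable_itv.
have -> : m `]0%R, 1%R[%classic = (\int[m]_(y in `]0%R, +oo[) (\1_`]0%R, 1%R[ y)%:E)%E.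
  rewrite integral_indic//; congr (m _).
  by apply/seteqP; split => y /=; rewrite !in_itv/= ?andbT; [move=> /andP[-> ->]|case].
rewrite -ge0_integralD//.
- apply: ge0_le_integral => //.
  + by move=> y /=; rewrite in_itv/= andbT lee_fin => y0; exact: bern_ge0.
  + by apply: emeasurable_funD => //; apply/measurable_EFinP.
  + move=> y /=; rewrite in_itv/= andbT => y0.
    rewrite -EFinD lee_fin.
    apply: (@le_trans _ _ 1); first by rewrite gerBl expR_ge0.
    rewrite indicE minElt; have [y1|y1] := ltP y 1.
      by rewrite mem_set/= ?in_itv/= ?y0 ?y1//; lra.
    by rewrite lerDr ler0n.
- by apply/measurable_EFinP.
Qed.

Lemma levy_measure_near0 : (0 < levy_density d m 1)%E -> WLSC Psi ->
  m `]0%R, 1%R[%classic = +oo%E.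
Proof.
move=> j1 [mu [c [theta [mu0 /andP[c0 c1] theta0 Psi_scale]]]].
apply/eqP; apply/negPn/negP; rewrite -ltey => m1.
have x0 : 0 < theta + 1 by lra.
have Psix := Psi_gt0 x0 j1.
have [C PsiC] : exists C, forall x, 0 < x -> Psi x <= C.
  have Sfin : (m `]0%R, 1%R[%classic +
     \int[m]_(y in `]0%R, +oo[) (Num.min y 1)%:E)%E \is a fin_num.
    by rewrite fin_numD levy_mass1_fin ge0_fin_numE ?m1.
  exists (fine (m `]0%R, 1%R[%classic +
     \int[m]_(y in `]0%R, +oo[) (Num.min y 1)%:E)%E) => x xgt0.
  by rewrite -lee_fin fineK//; exact: Psi_le.
have cP : 0 < c * Psi (theta + 1) by rewrite mulr_gt0.
pose g := Num.max 1 ((C + 1) / (c * Psi (theta + 1))).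
have g1 : 1 <= g by rewrite le_max lexx.
have g0 : 0 <= g by lra.
have gm : g <= g `^ mu^-1 `^ mu by rewrite -powRrM mulVf ?gt_eqF// powRr1.
have gamma1 : 1 <= g `^ mu^-1.
  have := @ge0_ler_powR R mu^-1 _ 1 g; rewrite powR1 !nnegrE; apply => //.
  by rewrite invr_ge0 ltW.
have xt : theta < theta + 1 by lra.
have := Psi_scale (theta + 1) _ xt gamma1.
rewrite leNgt => /negP; apply.
apply: (@le_lt_trans _ _ C); first by apply: PsiC; rewrite mulr_gt0//; lra.
have gC : (C + 1) / (c * Psi (theta + 1)) <= g by rewrite le_max lexx orbT.
rewrite ler_pdivrMr// in gC.
apply: (@lt_le_trans _ _ (g * (c * Psi (theta + 1)))); first by lra.
rewrite mulrAC mulrC ler_wpM2l// ?ltW//.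
Qed.

Definition far (n : nat) (rho : R) : set 'rV[R]_n := [set z | rho <= `|z|].

Lemma measurable_far (n : nat) (rho : R) : measurable (@far n rho).
Proof.
rewrite (_ : far _ = ~` [set z : 'rV[R]_n | `|z| < rho]).
  by apply: measurableC; exact: ball_measurable_rV.
by apply/seteqP; split => z; rewrite /far/= leNgt => /negP.
Qed.

Lemma levy_far_large (L : R) : (0 < d)%N ->
  (0 < levy_density d m 1)%E -> WLSC Psi ->
  exists2 rho : R, 0 < rho &
    (L%:E <= \int[@lebesgue_rV R d]_(z in far rho) levy_density d m (enorm z))%E.
Proof.
move=> d0 j1 wlsc.
pose F (n : nat) : set (measurableTypeR R) := `[((2^-1 ^+ n) ^+ 2)%R, 1%R[%classic.
have FU : \bigcup_n F n = `]0, 1[%classic.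
  apply/seteqP; split=> [t [n _]|t]; rewrite /F/= !in_itv/= => /andP[t0 t1].
    by rewrite t1 andbT (lt_le_trans _ t0)// !exprn_gt0.
  have [n _ /(_ n (leqnn n)) /= nt] : \forall n \near \oo, (2^-1 ^+ n < t :> R).
    apply: (cvgr_lt _ (cvg_expr _)) t0.
    by rewrite ger0_norm ?invr_ge0// invf_lt1//; lra.
  exists n => //; rewrite /= in_itv/= t1 andbT (le_trans _ (ltW nt))//.
  by rewrite expr2 ler_piMl ?exprn_ge0// exprn_ile1// invr_le1 ?unitfE//; lra.
have mF n : measurable (F n) by exact: measurable_itv.
have ndF : nondecreasing_seq F.
  move=> n k nk; apply/subsetPset => t; rewrite /F/= !in_itv/= => /andP[tn ->].
  rewrite andbT (le_trans _ tn)// lerXn2r ?nnegrE ?exprn_ge0//.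
  by rewrite ler_wiXn2l//; lra.
have mUF : measurable (\bigcup_n F n) by exact: bigcup_measurable.
have := nondecreasing_cvg_mu (mu := m) mF mUF ndF.
rewrite FU levy_measure_near0// => /cvgeyPge /(_ (L / shell_mass d)).
case=> n _ /(_ n (leqnn n)) /= Ln.
exists (2^-1 ^+ n); first by rewrite exprn_gt0.
have k0 := @shell_mass_gt0 R d.
apply: (@le_trans _ _ ((shell_mass d)%:E * m (F n))%E).
  by rewrite -lee_pdivrMl// -EFinM mulrC.
apply: (le_trans (@levy_dyadic_shells R m d n d0)).
apply: ge0_subset_integral.
- exact: measurable_box_itv.
- exact: measurable_far.
- by apply: measurable_funTS; exact: measurable_levy_enorm.
- by move=> z _; exact: levy_density_ge0.
- move=> z /(_ (Ordinal d0)); rewrite /far/= in_itv/= => /andP[zn _].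
  by rewrite (le_trans zn)// (le_trans (ler_norm _))// normr_coord_le.
Qed.

End infinite_levy_measure.

(** * The touching function and its nonlocal operator *)

Section test_function.
Context {R : realType} (n : nat).
Implicit Types (f g : 'rV[R]_n -> R) (x v : 'rV[R]_n).

Lemma near_eq_continuous_at f g x :
  (\near x, f x = g x) -> {for x, continuous g} -> {for x, continuous f}.
Proof.
move=> fg cg; have gf : {near x, g =1 f} by apply: filterS fg => y ->.
rewrite /prop_for /continuous_at (nbhs_singleton fg).
exact: (cvg_trans (near_eq_cvg gf) cg).
Qed.

Lemma near_eq_near_derive f g x v :
  (\near x, f x = g x) -> \near x, 'D_v f x = 'D_v g x.
Proof. by move=> /near_join; apply: filterS => y; exact: near_eq_derive. Qed.

Lemma is_derive_coord x v (i : 'I_n) :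
  is_derive x v (fun y : 'rV[R]_n => y ord0 i : R) (v ord0 i).
Proof.
have did : derivable (id : 'rV[R]_n -> 'rV[R]_n) x v by exact: derivable_id.
have dc : derivable (fun y : 'rV[R]_n => y ord0 i : R) x v.
  by move/derivable_mxP : did; exact.
apply: DeriveDef => //.
by have := derive_mx did; rewrite derive_id => /matrixP/(_ ord0 i) ->; rewrite mxE.
Qed.

Lemma is_derive_coordX x v (a : R) (i : 'I_n) (k : nat) :
  is_derive x v (fun y : 'rV[R]_n => (y ord0 i - a) ^+ k.+1 : R)
    (k.+1%:R * (x ord0 i - a) ^+ k * v ord0 i).
Proof.
have dc := is_derive_coord x v i.
have db : is_derive x v ((fun y : 'rV[R]_n => y ord0 i : R) - cst a) (v ord0 i).
  by apply: is_derive_eq; rewrite subr0.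
have -> : (fun y : 'rV[R]_n => (y ord0 i - a) ^+ k.+1 : R) =
    ((fun y : 'rV[R]_n => y ord0 i : R) - cst a) ^+ k.+1.
  by apply/funext => y; rewrite fctE.
exact: is_derive_eq.
Qed.

Lemma continuous_coordX (a c : R) (i : 'I_n) (k : nat) :
  continuous (fun y : 'rV[R]_n => c * (y ord0 i - a) ^+ k : R).
Proof.
have cX : continuous (fun y : 'rV[R]_n => (y ord0 i - a) ^+ k : R).
  elim: k => [|k IHk].
    rewrite (_ : (fun y => _) = cst 1) //; exact: cst_continuous.
  rewrite (_ : (fun y => _) =
    (fun y : 'rV[R]_n => (y ord0 i - a) * (y ord0 i - a) ^+ k)); last first.
    by apply/funext => y; rewrite exprS.
  move=> x; apply: (@cvgM _ _ (nbhs x) _); last exact: IHk.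
  by apply: (@cvgB _ _ _ (nbhs x) _); [exact: coord_continuous|exact: cvg_cst].
by move=> x; apply: (@cvgMl_tmp _ _ (nbhs x) _); exact: cX.
Qed.

Definition coord_power_sum (N : nat) (z : 'rV[R]_n) : R :=
  \sum_(i < n) z ord0 i ^+ N.

Lemma is_derive_coord_power_sum (M eta : R) (a x : 'rV[R]_n) (k : nat) (j : 'I_n) :
  is_derive x (delta_mx ord0 j)
    (fun y => M + eta * coord_power_sum k.+1 (y - a))
    (eta * k.+1%:R * (x ord0 j - a ord0 j) ^+ k).
Proof.
have -> : (fun y => M + eta * coord_power_sum k.+1 (y - a)) =
    cst M + eta *: \sum_(i < n) (fun y : 'rV[R]_n => (y ord0 i - a ord0 i) ^+ k.+1 : R).
  apply/funext => y; rewrite !fctE; congr (_ + _ * _).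
  by rewrite /coord_power_sum fct_sumE; apply: eq_bigr => i _; rewrite !mxE.
have dc (i : 'I_n) := is_derive_coordX x (delta_mx ord0 j) (a ord0 i) i k.
have dE : \sum_(i < n) k.+1%:R * (x ord0 i - a ord0 i) ^+ k *
    (delta_mx ord0 j : 'rV[R]_n) ord0 i = k.+1%:R * (x ord0 j - a ord0 j) ^+ k.
  rewrite (bigD1 j)//= big1 ?addr0 => [|i ij]; first by rewrite mxE !eqxx mulr1.
  by rewrite mxE eqxx (negbTE ij) mulr0.
have := is_deriveD (is_derive_cst (M : R) x (delta_mx ord0 j))
  (is_deriveZ eta (is_derive_sum dc)).
by move/is_derive_eq; apply; rewrite -mulrA -dE; exact: add0r.
Qed.

Lemma C2_near_coord_power_sum (M eta : R) (a x : 'rV[R]_n) (k : nat) f :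
  (\near x, f x = M + eta * coord_power_sum k.+2 (x - a)) -> C2_near f x.
Proof.
set P := fun y => M + eta * coord_power_sum k.+2 (y - a).
have dP (j : 'I_n) : 'D_(delta_mx ord0 j) P =
    fun y => eta * k.+2%:R * (y ord0 j - a ord0 j) ^+ k.+1.
  by apply/funext => y; have [] := is_derive_coord_power_sum M eta a y k.+1 j.
have ddP (i j : 'I_n) y : is_derive y (delta_mx ord0 j) ('D_(delta_mx ord0 i) P)
    (eta * k.+2%:R * k.+1%:R * (y ord0 i - a ord0 i) ^+ k * (i == j)%:R).
  have dc := is_derive_coordX y (delta_mx ord0 j) (a ord0 i) i k.
  rewrite dP (_ : (fun y => _) = (eta * k.+2%:R) *:
    (fun y : 'rV[R]_n => (y ord0 i - a ord0 i) ^+ k.+1 : R))//.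
  by apply: is_derive_eq; rewrite /GRing.scale/= !mxE eqxx/= !mulrA.
move=> /near_join; apply: filterS => y fP; split.
  apply: (near_eq_continuous_at fP).
  rewrite (_ : (fun y => _) = (fun y : 'rV[R]_n =>
    M + \sum_(i < n) eta * (y ord0 i - a ord0 i) ^+ k.+2 : R)); last first.
    apply/funext => w; rewrite mulr_sumr.
    by congr (_ + _); apply: eq_bigr => i _; rewrite !mxE.
  apply: (@cvgD _ _ _ (nbhs y) _); first exact: cvg_cst.
  apply: (cvg_big (F := nbhs y) (@add_continuous _)) => i _.
  exact: continuous_coordX.
move=> i /=; have DfP := near_eq_near_derive (delta_mx ord0 i) fP; split.
- apply: near_eq_derivable (@ex_derive _ _ _ _ _ _ _
    (is_derive_coord_power_sum M eta a y k.+1 i)).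
  by apply: filterS fP => w ->.
- apply: (near_eq_continuous_at DfP); rewrite dP; exact: continuous_coordX.
move=> j; split.
- apply: near_eq_derivable (@ex_derive _ _ _ _ _ _ _ (ddP i j y)).
  by apply: filterS DfP => w ->.
- apply: (near_eq_continuous_at (near_eq_near_derive (delta_mx ord0 j) DfP)).
  rewrite (_ : 'D_(delta_mx ord0 j) _ = fun y =>
    eta * k.+2%:R * k.+1%:R * (i == j)%:R * (y ord0 i - a ord0 i) ^+ k).
    exact: continuous_coordX.
  by apply/funext => w; have [_ ->] := ddP i j w; rewrite mulrAC.
Qed.

End test_function.

Section main_estimates.
Context {R : realType}.
Variables (d : nat) (m : {measure set (measurableTypeR R) -> \bar R}).

Local Notation j z := (levy_density d m (enorm z)).
Local Notation leb := (@lebesgue_rV R d).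

Lemma levy_density_far (rho : R) (z : 'rV[R]_d) : 0 < rho -> far rho z ->
  (j z <= levy_density d m rho)%E.
Proof.
move=> rho0 farz; apply: le_levy_density.
rewrite gtr0_norm// ger0_norm ?enorm_ge0//.
exact: le_trans farz (normr_le_enorm z).
Qed.

Lemma levy_far_removal (Psi : R -> R) (K : R) : (0 < d)%N ->
  zero_drift Psi m -> WLSC Psi ->
  (forall r : R, 0 < r -> (0 < levy_density d m r < +oo)%E) ->
  exists rho e : R, [/\ 0 < rho, 0 < e &
    forall G : set 'rV[R]_d, measurable G -> (leb (~` G) <= e%:E)%E ->
      (K%:E <= \int[leb]_(z in far rho `&` G) j z)%E].
Proof.
move=> d0 Psi_m wlsc jfin.
have [rho rho0 big] := levy_far_large Psi_m (K + 1) d0 (andP (jfin 1 ltr01)).1 wlsc.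
have /andP[jr0 jroo] := jfin _ rho0.
have jr_fin : levy_density d m rho \is a fin_num by rewrite gt0_fin_numE.
have fjr0 : 0 < fine (levy_density d m rho) by rewrite -lte_fin fineK.
exists rho, (fine (levy_density d m rho))^-1; split => // [|G mG Ge].
  by rewrite invr_gt0.
have mfar := @measurable_far R d rho.
have mj (A : set 'rV[R]_d) : measurable_fun A (fun z => j z).
  by apply: measurable_funTS; exact: measurable_levy_enorm.
have mFG : measurable (far rho `&` G) by exact: measurableI.
have mGC : measurable (~` G) by exact: measurableC.
have mFD : measurable (far rho `\` G) by exact: measurableD.
have : ((K + 1)%:E <= \int[leb]_(z in far rho `&` G) j z +
                      \int[leb]_(z in far rho `\` G) j z)%E.
  rewrite -ge0_integral_setU//.
  - by rewrite setUIDK.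
  - by move=> z _; exact: levy_density_ge0.
  - by apply/disj_setPS => z [[_ ?] []].
have off : (\int[leb]_(z in far rho `\` G) j z <= 1)%E.
  apply: (@le_trans _ _ (\int[leb]_(z in far rho `\` G) cst (levy_density d m rho) z)%E).
    apply: ge0_le_integral => //.
    - by move=> z _; exact: levy_density_ge0.
    - by move=> z [farz _]; exact: levy_density_far.
  rewrite integral_cst//.
  apply: (@le_trans _ _ (levy_density d m rho * (fine (levy_density d m rho))^-1%:E)%E).
    rewrite lee_wpmul2l ?(ltW jr0)//; apply: le_trans Ge.
    by apply: le_measure; [rewrite inE|rewrite inE|move=> z []].
  by rewrite -{1}(fineK jr_fin) -EFinM divff// gt_eqF.
move=> /le_trans /(_ (leeD2l _ off)); rewrite EFinD.
by rewrite leeD2rE.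
Qed.

Lemma integral_levy_le (F : 'rV[R]_d -> R) (G : set 'rV[R]_d)
    (rho eta M C J e K : R) :
  measurable_fun setT (F : 'rV[R]_d -> measurableTypeR R) -> measurable G ->
  0 < rho -> 0 <= eta <= M -> 0 <= C -> 0 <= J ->
  (levy_density d m rho <= J%:E)%E ->
  (leb (~` G) <= e%:E)%E ->
  (K%:E <= \int[leb]_(z in far rho `&` G) j z)%E ->
  (forall z, `|z| < rho -> ((F z)%:E * j z <= (2 * eta * C)%:E)%E) ->
  (forall z, far rho z -> F z <= 2 * eta) ->
  (forall z, far rho z -> G z -> F z <= 2 * eta - 2 * M) ->
  (\int[leb]_z ((F z)%:E * j z) <=
   (2 * eta * (C * (2 * rho) ^+ d + J * e) - (2 * M - 2 * eta) * K)%:E)%E.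
Proof.
move=> mF mG rho0 /andP[eta0 etaM] C0 J0 jJ Ge KG Fnear Ffar FG.
pose f z := ((F z)%:E * j z)%E.
have mj (A : set 'rV[R]_d) : measurable_fun A (fun z => j z).
  by apply: measurable_funTS; exact: measurable_levy_enorm.
have mf : measurable_fun setT f.
  by apply: emeasurable_funM => //; apply/measurable_EFinP.
pose B := [set z : 'rV[R]_d | `|z| < rho].
have mB : measurable B by exact: ball_measurable_rV.
have mGC : measurable (~` G) by exact: measurableC.
have j0 z : (0 <= j z)%E by exact: levy_density_ge0.
rewrite integralE EFinB; apply: leeB.
- pose h z : \bar R :=
    ((2 * eta * C)%:E * (\1_B z)%:E + (2 * eta * J)%:E * (\1_(~` G) z)%:E)%E.
  have c1 : 0 <= 2 * eta * C by rewrite !mulr_ge0.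
  have c2 : 0 <= 2 * eta * J by rewrite !mulr_ge0.
  have h1 z : (0 <= (2 * eta * C)%:E * (\1_B z)%:E)%E.
    by rewrite mule_ge0// lee_fin.
  have h2 z : (0 <= (2 * eta * J)%:E * (\1_(~` G) z)%:E)%E.
    by rewrite mule_ge0// lee_fin.
  have mi (A : set 'rV[R]_d) :
      measurable A -> measurable_fun setT (fun z => (\1_A z)%:E : \bar R).
    by move=> mA; apply/measurable_EFinP; exact: measurable_indic.
  apply: (@le_trans _ _ (\int[leb]_z h z)%E).
    apply: ge0_le_integral => //.
    + exact: measurable_funepos.
    + by apply: emeasurable_funD; apply: measurable_funeM; exact: mi.
    + move=> z _; rewrite /h funeposE ge_max adde_ge0// andbT.
      have [zr|rz] := ltP `|z| rho.
        rewrite [\1_B z]indicE mem_set// mule1.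
        by apply: (le_trans (Fnear _ zr)); rewrite leeDl.
      have [zG|zG] := pselect (G z).
        apply: (@le_trans _ _ 0%E); last exact: adde_ge0.
        rewrite /f mule_le0_ge0// lee_fin.
        by apply: (le_trans (FG _ rz zG)); lra.
      rewrite [\1_(~` G) z]indicE mem_set// mule1.
      apply: (@le_trans _ _ (2 * eta * J)%:E); last by rewrite leeDr.
      apply: (@le_trans _ _ ((2 * eta)%:E * j z)%E).
        by rewrite lee_wpmul2r// lee_fin Ffar.
      rewrite [leRHS]EFinM lee_wpmul2l ?lee_fin ?mulr_ge0//.
      by apply: le_trans jJ; exact: levy_density_far.
  rewrite ge0_integralD//; last 2 first.
    by apply: measurable_funeM; exact: mi.
    by apply: measurable_funeM; exact: mi.
  rewrite !ge0_integralZl//; last 2 first.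
    exact: mi.
    exact: mi.
  rewrite !integral_indic// !setIT mulrDr EFinD !mulrA.
  apply: leeD.
    rewrite [leRHS]EFinM lee_wpmul2l//.
    by rewrite le_eqVlt; apply/orP; left; apply/eqP; exact: lebesgue_rV_ball.
  by rewrite [leRHS]EFinM lee_wpmul2l// lee_fin.
- have mFG : measurable (far rho `&` G).
    by apply: measurableI => //; exact: measurable_far.
  have c0 : 0 <= 2 * M - 2 * eta by lra.
  apply: (@le_trans _ _ (\int[leb]_(z in far rho `&` G) ((2 * M - 2 * eta)%:E * j z))%E).
    by rewrite ge0_integralZl// EFinM lee_wpmul2l// lee_fin.
  apply: (@le_trans _ _ (\int[leb]_(z in far rho `&` G) f^\- z)%E).
    apply: ge0_le_integral => //.
    + by move=> z _; rewrite mule_ge0// lee_fin.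
    + by apply: measurable_funeM.
    + by apply: measurable_funTS; exact: measurable_funeneg.
    + move=> z [farz Gz]; rewrite funenegE le_max /f -mulNe; apply/orP; left.
      rewrite lee_wpmul2r// -EFinN lee_fin lerNr.
      by apply: (le_trans (FG _ farz Gz)); lra.
  by apply: ge0_subset_integral => //; exact: measurable_funeneg.
Qed.

End main_estimates.

Section touching_function.
Context {R : realType} (d : nat).
Variables (D : set 'rV[R]_d) (x0 : 'rV[R]_d) (rho M eta : R).

(* The exponent makes the function flat enough at x0 for its increments to be
   bounded against the Levy density without using the cancellation between
   phi (x0 + z) and phi (x0 - z). *)
Definition touching (y : 'rV[R]_d) : R :=
  if `|y - x0| < rho then M + eta * coord_power_sum (2 * d.+1) (y - x0)
  else if `[< D y >] then M + eta else eta.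

Hypothesis rho_gt0 : 0 < rho.
Hypothesis M_ge0 : 0 <= M.
Hypothesis eta_gt0 : 0 < eta.

Lemma coord_power_sum_ge0 (z : 'rV[R]_d) (k : nat) :
  0 <= coord_power_sum (2 * k) z.
Proof. by apply: sumr_ge0 => i _; rewrite exprM exprn_ge0// sqr_ge0. Qed.

Lemma coord_power_sum_gt0 (z : 'rV[R]_d) (k : nat) : z != 0 ->
  0 < coord_power_sum (2 * k) z.
Proof.
move=> z0; have [i zi] : exists i, z ord0 i != 0.
  apply: contrapT => nz; move/negP : z0; apply; apply/eqP/rowP => i.
  by rewrite mxE; apply/eqP/negPn/negP => zi; apply: nz; exists i.
rewrite /coord_power_sum (bigD1 i)//= ltr_wpDr//.
  by apply: sumr_ge0 => l _; rewrite exprM exprn_ge0// sqr_ge0.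
by rewrite exprM exprn_gt0// lt_neqAle sqr_ge0 andbT eq_sym sqrf_eq0.
Qed.

Lemma coord_power_sum_le (z : 'rV[R]_d) (k : nat) (r : R) :
  (forall i, `|z ord0 i| <= r) -> coord_power_sum (2 * k) z <= d%:R * r ^+ (2 * k).
Proof.
move=> zr; rewrite mulr_natl -[X in _ *+ X]card_ord -sumr_const.
apply: ler_sum => i _; rewrite !exprM lerXn2r ?nnegrE ?sqr_ge0//.
rewrite -(real_normK (num_real (z ord0 i))) lerXn2r ?nnegrE//.
exact: le_trans (zr i).
Qed.

Lemma coord_power_sumN (z : 'rV[R]_d) (k : nat) :
  coord_power_sum (2 * k) (- z) = coord_power_sum (2 * k) z.
Proof. by apply: eq_bigr => i _; rewrite mxE !exprM sqrrN. Qed.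

Lemma coord_power_sum0 (k : nat) : coord_power_sum (2 * k.+1) (0 : 'rV[R]_d) = 0.
Proof. by apply: big1 => i _; rewrite mxE expr0n. Qed.

Lemma touching_center : touching x0 = M.
Proof. by rewrite /touching subrr normr0 rho_gt0 coord_power_sum0 mulr0 addr0. Qed.

Lemma touching_near : \forall y \near x0,
  touching y = M + eta * coord_power_sum (2 * d.+1) (y - x0).
Proof.
have : nbhs x0 (ball x0 rho) by exact: nbhsx_ballx.
by apply: filterS => y; rewrite -ball_normE/= distrC /touching => ->.
Qed.

Lemma measurable_coord_power_sum (N : nat) :
  measurable_fun setT (fun z : 'rV[R]_d => coord_power_sum N z : measurableTypeR R).
Proof.
apply: measurable_sum => i; apply: measurable_funX.
exact: measurable_coord_rV.
Qed.

Lemma measurable_touching : measurable D ->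
  measurable_fun setT (touching : 'rV[R]_d -> measurableTypeR R).
Proof.
move=> mD.
have ms : measurable_fun setT (fun y : 'rV[R]_d => y - x0).
  rewrite (_ : (fun y => _) = fun y : 'rV[R]_d => - x0 + 1 *: y).
    exact: measurable_affine_rV.
  by apply/funext => y; rewrite scale1r addrC.
apply: measurable_fun_ifT.
- apply: (measurable_fun_bool true); rewrite setTI.
  have := ms measurableT _ (@ball_measurable_rV R d rho); rewrite setTI.
  by congr (measurable _); apply/seteqP; split.
- apply: measurable_funD => //; apply: measurable_funM => //.
  exact: (measurableT_comp (measurable_coord_power_sum _) ms).
- apply: measurable_fun_ifT => //.
  apply: (measurable_fun_bool true); rewrite setTI.
  by rewrite (_ : _ @^-1` _ = D)//; apply/seteqP; split => y /= /asboolP.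
Qed.

Lemma C2b_touching : measurable D -> C2b touching x0.
Proof.
move=> mD; split; first exact: measurable_touching.
  exists (M + eta * (d%:R * rho ^+ (2 * d.+1) + 1)); split; first exact: num_real.
  move=> b Mb y _; apply: le_trans (ltW Mb).
  have r0 : 0 <= d%:R * rho ^+ (2 * d.+1) by rewrite mulr_ge0// exprn_ge0// ltW.
  rewrite /touching; case: ifPn => [yr|_].
    have s1 := coord_power_sum_ge0 (y - x0) d.+1.
    have s2 : coord_power_sum (2 * d.+1) (y - x0) <= d%:R * rho ^+ (2 * d.+1).
      apply: coord_power_sum_le => i.
      exact: le_trans (normr_coord_le _ _) (ltW yr).
    rewrite ger0_norm ?addr_ge0 ?mulr_ge0 ?(ltW eta_gt0)// lerD2l.
    by rewrite ler_wpM2l ?(ltW eta_gt0)//; lra.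
  have e0 : 0 <= eta * (d%:R * rho ^+ (2 * d.+1)) by rewrite mulr_ge0// ltW.
  have eta0 := ltW eta_gt0.
  case: ifPn => _; rewrite ger0_norm ?addr_ge0// mulrDr mulr1.
    by rewrite lerD2l lerDr.
  by rewrite addrA lerDr addr_ge0.
apply: (C2_near_coord_power_sum (M := M) (eta := eta) (a := x0) (k := 2 * d)).
have -> : (2 * d).+2 = (2 * d.+1)%N by rewrite mulnS.
exact: touching_near.
Qed.

Lemma touching_gt (u : 'rV[R]_d -> R) (y : 'rV[R]_d) :
  (forall z, u z <= M) -> (forall z, ~ D z -> u z <= 0) -> y != x0 ->
  u y < touching y.
Proof.
move=> uM u0 yx; rewrite /touching; case: ifPn => _.
  rewrite (le_lt_trans (uM y))// ltrDl mulr_gt0// coord_power_sum_gt0//.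
  by rewrite subr_eq0.
case: asboolP => [_|/u0 uy]; last exact: le_lt_trans eta_gt0.
by rewrite (le_lt_trans (uM y))// ltrDl.
Qed.

Definition touching_diff (z : 'rV[R]_d) : R :=
  touching (x0 + z) + touching (x0 - z) - 2 * touching x0.

Lemma touching_diff_near (z : 'rV[R]_d) : `|z| < rho ->
  touching_diff z = 2 * eta * coord_power_sum (2 * d.+1) z.
Proof.
move=> zr; rewrite /touching_diff touching_center /touching.
rewrite ![x0 + _]addrC !addrK normrN zr coord_power_sumN; ring.
Qed.

Lemma touching_diff_far (z : 'rV[R]_d) : far rho z -> touching_diff z <= 2 * eta.
Proof.
move=> zr; rewrite /touching_diff touching_center /touching.
rewrite ![x0 + _]addrC !addrK normrN ltNge zr/=.
by have M0 := M_ge0; case: ifPn => _; case: ifPn => _; lra.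
Qed.

Lemma touching_diff_off (z : 'rV[R]_d) : far rho z ->
  ~ D (x0 + z) -> ~ D (x0 - z) -> touching_diff z <= 2 * eta - 2 * M.
Proof.
move=> zr D1 D2; rewrite /touching_diff touching_center /touching.
rewrite !asboolF// ![x0 + _]addrC !addrK normrN ltNge zr/=; lra.
Qed.

Lemma measurable_touching_diff : measurable D ->
  measurable_fun setT (touching_diff : 'rV[R]_d -> measurableTypeR R).
Proof.
move=> mD; have mt := measurable_touching mD.
apply: measurable_funB => //; apply: measurable_funD.
  rewrite (_ : (fun z => _) = touching \o (fun z => x0 + 1 *: z)).
    exact: (measurableT_comp mt (measurable_affine_rV _ _)).
  by apply/funext => z /=; rewrite scale1r.
rewrite (_ : (fun z => _) = touching \o (fun z => x0 + (-1) *: z)).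
  exact: (measurableT_comp mt (measurable_affine_rV _ _)).
by apply/funext => z /=; rewrite scaleN1r.
Qed.

End touching_function.

Lemma coord_power_sum_levy_le (R : realType) (d : nat) (Psi : R -> R)
    (m : {measure set (measurableTypeR R) -> \bar R}) (rho : R) :
  zero_drift Psi m -> 0 < rho -> exists2 C : R, 0 <= C &
    forall z : 'rV[R]_d, `|z| < rho ->
    ((coord_power_sum (2 * d.+1) z)%:E * levy_density d m (enorm z) <= C%:E)%E.
Proof.
move=> Psi_m rho0.
set I := (\int[m]_(y in `]0%R, +oo[) (Num.min y 1)%:E)%E.
have Ifin : I \is a fin_num by exact: levy_mass1_fin Psi_m.
have I0 : (0 <= I)%E by exact: levy_mass1_ge0.
pose r0 := d%:R * rho.
pose c := r0 ^+ (2 * d.+1) + 2 * (4 ^+ d.+1 * d.+1`!%:R).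
have r00 : 0 <= r0 by rewrite mulr_ge0// ltW.
have c0 : 0 <= c by rewrite addr_ge0 ?mulr_ge0 ?exprn_ge0.
exists (d%:R * (c * fine I)); first by rewrite !mulr_ge0// fine_ge0.
move=> z zr.
have zr0 : 0 <= enorm z <= r0.
  rewrite enorm_ge0/= -(@ler_pXn2r _ 2) ?nnegrE ?enorm_ge0//.
  have zi (i : 'I_d) : `|z ord0 i| <= rho.
    exact: le_trans (normr_coord_le _ _) (ltW zr).
  rewrite sqr_enorm; apply: le_trans (coord_power_sum_le 1 zi) _; rewrite muln1.
  rewrite exprMn ler_wpM2r ?sqr_ge0// expr2; case: (d) => [|k]; first by rewrite mul0r.
  by rewrite ler_peMl// ler1n.
apply: (@le_trans _ _ ((d%:R * enorm z ^+ (2 * d.+1))%:E * levy_density d m (enorm z))%E).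
  rewrite lee_wpmul2r ?levy_density_ge0// lee_fin.
  apply: coord_power_sum_le => i; exact: normr_coord_le_enorm.
rewrite EFinM -muleA [leRHS]EFinM lee_wpmul2l ?lee_fin//.
apply: (le_trans (levy_density_le d m zr0)).
by rewrite EFinM fineK.
Qed.

Theorem corollary3p1 (R : realType) (d : nat) (Psi : R -> R)
    (m : {measure set (measurableTypeR R) -> \bar R}) :
  (2 <= d)%N ->
  bernstein0 Psi ->
  zero_drift Psi m ->
  (forall r : R, 0 < r -> (0 < levy_density d m r < +oo)%E) ->
  WLSC Psi ->
  exists eps : R -> R -> R,
    (forall delta K : R, 0 < eps delta K) /\
    forall (D : set 'rV[R]_d) (c u : 'rV[R]_d -> R),
      open D -> connected D -> bounded_set D -> C11_boundary D -> D 0 ->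
      {within D, continuous c} -> [bounded c x | x in D] ->
      continuous u -> bounded_fun u ->
      viscosity_subsolution m D c (fun=> 0) u ->
      (forall x, ~ D x -> u x <= 0) ->
      (lebesgue_rV D < (eps (diam D) (sup_norm D c))%:E)%E ->
      forall x, u x <= 0.
Proof.
move=> d2 _ Psi_m jfin wlsc; have d0 : (0 < d)%N by exact: ltnW.
have /choice[e_ eP] (K : R) := levy_far_removal (`|K| + 1) d0 Psi_m wlsc jfin.
have /choice[e eP'] (K : R) : exists e : R, 0 < e /\ exists rho : R, 0 < rho /\
    forall G : set 'rV[R]_d, measurable G -> (lebesgue_rV (~` G) <= e%:E)%E ->
    ((`|K| + 1)%:E <=
     \int[@lebesgue_rV R d]_(z in far rho `&` G) levy_density d m (enorm z))%E.
  by have [e [e0 rho0 eG]] := eP K; exists e; split => //; exists (e_ K).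
exists (fun _ K => e K / 2); split=> [_ K|D c u oD _ bD _ D0 _ cb cu _ usub u0 De x1].
  by have [e0 _] := eP' K; rewrite divr_gt0.
rewrite leNgt; apply/negP => ux1.
set K := sup_norm D c in De.
have [e0 [rho [rho0 farG]]] := eP' K.
have mD : measurable D by exact: open_measurable_rV.
have [x0 Dx0 maxu] : exists2 x0, D x0 & forall y, u y <= u x0.
  have cD : compact (closure D).
    apply: bounded_closed_compact; last exact: closed_closure.
    case: bD => b [_ /(_ (b + 1))]; rewrite ltrDl => /(_ ltr01) bD.
    exists (b + 1 + 1); split; first exact: num_real.
    move=> N bN x /(_ _ (nbhsx_ballx x 1 ltr01)) [y [/bD yb]].
    rewrite -ball_normE/= => xy; apply: le_trans (ltW bN).
    by rewrite -(subrK y x) addrC (le_trans (ler_normD _ _))// lerD// ltW.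
  have D_in x : 0 < u x -> D x.
    by move=> ux; apply: contrapT => /u0; rewrite leNgt ux.
  have [x0 _ maxu] : exists2 x0, x0 \in closure D &
      forall t, t \in closure D -> u t <= u x0.
    apply: EVT_max_rV => //; first by exists 0; exact: subset_closure.
    exact: continuous_subspaceT.
  have clD x : D x -> x \in closure D by move=> Dx; rewrite inE; exact: subset_closure.
  have ux0 : 0 < u x0 := lt_le_trans ux1 (maxu _ (clD _ (D_in _ ux1))).
  exists x0; first exact: D_in.
  move=> y; have [Dy|Dy] := pselect (D y); first exact/maxu/clD.
  by rewrite (le_trans (u0 _ Dy))// ltW.
have M0 : 0 < u x0 := lt_le_trans ux1 (maxu x1).
set M := u x0 in maxu M0.
have cK : c x0 <= `|K|.
  apply: (@le_trans _ _ K); last exact: ler_norm.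
  apply: le_trans (ler_norm _) _; apply: ub_le_sup; last by exists x0.
  case: cb => b [_ /(_ (b + 1))]; rewrite ltrDl => /(_ ltr01) cb1.
  by exists (b + 1) => _ [x Dx <-]; exact: cb1.
pose G := [set z : 'rV[R]_d | ~ D (x0 + z) /\ ~ D (x0 - z)].
have GC : ~` G = [set z | D (x0 + 1 *: z)] `|` [set z | D (x0 + (-1) *: z)].
  apply/seteqP; split => z /=; rewrite scale1r scaleN1r /G/= not_andP.
    by move=> [/contrapT|/contrapT]; [left|right].
  by move=> []; [left|right]; exact.
have mA sg : measurable [set z | D (x0 + sg *: z)].
  by have := measurable_affine_rV x0 sg measurableT mD; rewrite setTI.
have mG : measurable G.
  by rewrite -[G]setCK GC; apply: measurableC; exact: measurableU.
have Ge : (lebesgue_rV (~` G) <= (e K)%:E)%E.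
  rewrite GC (le_trans (measureU2 _ (mA _) (mA _)))//.
  rewrite (splitr (e K)) EFinD; apply: leeD.
    by apply: le_trans (ltW De); rewrite le_eqVlt; apply/orP; left; apply/eqP;
      apply: lebesgue_rV_affine => //; left.
  by apply: le_trans (ltW De); rewrite le_eqVlt; apply/orP; left; apply/eqP;
    apply: lebesgue_rV_affine => //; right.
have [C C0 jC] := @coord_power_sum_levy_le R d Psi m rho Psi_m rho0.
have /andP[jr0 jroo] := jfin _ rho0.
have jr_fin : levy_density d m rho \is a fin_num by rewrite gt0_fin_numE.
pose J := fine (levy_density d m rho).
have J0 : 0 <= J by rewrite fine_ge0// ltW.
pose A := C * (2 * rho) ^+ d + J * e K.
have A0 : 0 <= A by rewrite addr_ge0 ?mulr_ge0 ?exprn_ge0 ?mulr_ge0 ?(ltW rho0) ?(ltW e0).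
have K0 := normr_ge0 K.
pose eta := M / (A + (`|K| + 1) + 1).
have den0 : 0 < A + (`|K| + 1) + 1 by lra.
have eta0 : 0 < eta by rewrite divr_gt0.
have etaM : eta * (A + (`|K| + 1) + 1) = M by rewrite divfK// gt_eqF.
have etaM1 : 0 <= eta <= M by rewrite ltW//=; nra.
have := usub x0 (touching D x0 rho M eta) Dx0
  (C2b_touching x0 rho0 (ltW M0) eta0 mD) (touching_center D x0 M eta rho0)
  (fun y yx => touching_gt rho eta0 maxu u0 yx).
have := @integral_levy_le R d m (touching_diff D x0 rho M eta) G
  rho eta M C J (e K) (`|K| + 1)
  (measurable_touching_diff x0 rho M eta mD) mG rho0 etaM1 C0 J0.
rewrite fineK// => /(_ (lexx _) Ge (farG _ mG Ge)) int_le.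
rewrite /nonlocal_op => sub; move: sub; rewrite leNgt => /negP; apply.
apply: (@le_lt_trans _ _ ((2^-1)%:E *
  (2 * eta * A - (2 * M - 2 * eta) * (`|K| + 1))%:E + (c x0 * M)%:E)%E).
  rewrite leeD2r// lee_wpmul2l//; apply: int_le.
  - move=> z zr; rewrite touching_diff_near// EFinM -muleA [leRHS]EFinM.
    by apply: lee_wpmul2l; [rewrite lee_fin mulr_ge0// ltW|exact: jC].
  - by move=> z; apply: touching_diff_far => //; exact: ltW.
  - by move=> z zfar [D1 D2]; apply: touching_diff_off.
rewrite -EFinM -EFinD lte_fin.
have cM : c x0 * M <= `|K| * M by rewrite ler_wpM2r// ltW.
nra.
Qed.
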